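(* Let $\mathcal{C}$ be a category with kernel pairs and split pullbacks. The following are equivalent: (i') every reflexive relation in $\mathcal{C}$ is an equivalence relation; (ii') every reflexive relation in $\mathcal{C}$ is a preorder; (iii') every reflexive relation in $\mathcal{C}$ is transitive; (iv') every relation in $\mathcal{C}$ is difunctional; (v') for all morphisms $f\colon A\to B$, $r\colon B\to A$, $g\colon C\to B$, $s\colon B\to C$, $\alpha\colon A\to D$, $\beta\colon B\to D$, $\gamma\colon C\to D$ in $\mathcal{C}$ with $fr=1_B=gs$ and $\alpha r=\beta=\gamma s$, and for every relation $D_0\xleftarrow{d} D\xrightarrow{c} D_0'$ in $\mathcal{C}$ such that $d\alpha=d\beta f$ and $c\gamma=c\beta g$, there is a unique morphism $\varphi\colon A\times_B C\to D$ such that $$\varphi e_1=\alpha,\quad \varphi e_2=\gamma,\quad d\varphi=d\gamma\pi_2,\quad c\varphi=c\alpha\pi_1,$$ where $A\times_B C$ is the pullback of $f$ and $g$ with projections $\pi_1\colon A\times_BC\to A$, $\pi_2\colon A\times_BC\to C$, and $e_1=\langle 1_A, sf\rangle\colon A\to A\times_B C$, $e_2=\langle rg,1_C\rangle\colon C\to A\times_B C$.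
   Context: A category $\mathcal{C}$ has kernel pairs if the pullback of any morphism along itself exists; it has split pullbacks if the pullback of a split epimorphism along a split epimorphism always exists. No binary products are assumed. $\langle\cdot,\cdot\rangle$ denotes a morphism induced into a pullback. A relation is a span $D_0\xleftarrow{d}D\xrightarrow{c}D_0'$ whose legs $d,c$ are jointly monomorphic. A reflexive graph in $\mathcal{C}$ consists of $d,c\colon C_1\to C_0$, $e\colon C_0\to C_1$ with $de=1_{C_0}=ce$. A multiplicative graph is a reflexive graph together with $m\colon C_2\to C_1$, where $C_2$ is the pullback of $d$ and $c$, with projections $\pi_1,\pi_2$, $d\pi_1=c\pi_2$, such that $m\langle 1_{C_1},ed\rangle=1_{C_1}=m\langle ec,1_{C_1}\rangle$, $dm=d\pi_2$, $cm=c\pi_1$. An internal category is a multiplicative graph satisfying $m(1\times m)=m(m\times 1)$. An internal groupoid is an internal category for which there is $t\colon C_1\to C_1$ with $ct=d$, $dt=c$, $m\langle 1_{C_1},t\rangle=ec$, $m\langle t,1_{C_1}\rangle=ed$. A reflexive relation is a reflexive graph with $(d,c)$ jointly monomorphic. It is transitive if it admits a multiplicative graph structure $m$; it is a preorder (reflexive and transitive relation) if it underlies an internal category (or multiplicative graph); it is an equivalence relation if it underlies an internal groupoid. A pregroupoid structure on a span $D_0\xleftarrow{d}D\xrightarrow{c}D_0'$ is a morphism $p\colon D\times_{D_0}D\times_{D_0'}D\to D$, where the domain is the pullback of the second projection of the kernel pair $D\times_{D_0}D$ of $d$ along the first projection of the kernel pair $D\times_{D_0'}D$ of $c$ (generalised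 elements: triples $(x,y,z)$ with $dx=dy$, $cy=cz$), such that $p(x,y,y)=x$ (when $dx=dy$), $p(x,x,y)=y$ (when $cx=cy$), $dp(x,y,z)=dz$ and $cp(x,y,z)=cx$. A relation is difunctional if it admits a pregroupoid structure. *)

(* Defs.v *)
From mathcomp Require Import all_boot.

Set Implicit Arguments.
Unset Strict Implicit.
Unset Printing Implicit Defensive.

Declare Scope category_scope.
Delimit Scope category_scope with cat.
Local Open Scope category_scope.

Reserved Notation "g ∘ f" (at level 40, left associativity).

(* Morphisms are compared with Leibniz equality; [comp g f] is "g after f".   *)
Record category := Category {
  obj :> Type;
  hom : obj -> obj -> Type;
  idm : forall A : obj, hom A A;
  comp : forall A B C : obj, hom B C -> hom A B -> hom A C;
  comp_idl : forall (A B : obj) (f : hom A B), comp (idm B) f = f;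
  comp_idr : forall (A B : obj) (f : hom A B), comp f (idm A) = f;
  comp_assoc : forall (A B C D : obj)
    (h : hom C D) (g : hom B C) (f : hom A B),
    comp h (comp g f) = comp (comp h g) f
}.

Arguments idm {c} A.

Notation "g ∘ f" := (comp g f) : category_scope.

(* [pb_pair a b H] is the induced morphism <a, b>; it does not depend on the  *)
(* proof H that the square commutes, by [pb_uniq].                            *)
Record pullback (C : category) (A B D : C) (f : hom A D) (g : hom B D) :=
  Pullback {
  pb_obj :> C;
  pb1 : hom pb_obj A;
  pb2 : hom pb_obj B;
  pb_comm : f ∘ pb1 = g ∘ pb2;
  pb_pair : forall (X : C) (a : hom X A) (b : hom X B),
    f ∘ a = g ∘ b -> hom X pb_obj;
  pb1_pair : forall (X : C) (a : hom X A) (b : hom X B) (H : f ∘ a = g ∘ b),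
    pb1 ∘ pb_pair H = a;
  pb2_pair : forall (X : C) (a : hom X A) (b : hom X B) (H : f ∘ a = g ∘ b),
    pb2 ∘ pb_pair H = b;
  pb_uniq : forall (X : C) (h k : hom X pb_obj),
    pb1 ∘ h = pb1 ∘ k -> pb2 ∘ h = pb2 ∘ k -> h = k
}.

Arguments pb_pair {C A B D f g} p {X} a b H.

Definition split_epi (C : category) (A B : C) (f : hom A B) : Prop :=
  exists s : hom B A, f ∘ s = idm B.

Definition has_kernel_pairs (C : category) : Prop :=
  forall (A B : C) (f : hom A B), inhabited (pullback f f).

Definition has_split_pullbacks (C : category) : Prop :=
  forall (A B D : C) (f : hom A D) (g : hom B D),
    split_epi f -> split_epi g -> inhabited (pullback f g).

Definition jointly_monic (C : category) (D D0 D0' : C)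
    (d : hom D D0) (c : hom D D0') : Prop :=
  forall (X : C) (x y : hom X D), d ∘ x = d ∘ y -> c ∘ x = c ∘ y -> x = y.

Definition is_relation (C : category) (D D0 D0' : C)
    (d : hom D D0) (c : hom D D0') : Prop := jointly_monic d c.

Record reflexive_graph (C : category) := ReflexiveGraph {
  C0 : C;
  C1 : C;
  dom : hom C1 C0;
  cod : hom C1 C0;
  unt : hom C0 C1;
  dom_unt : dom ∘ unt = idm C0;
  cod_unt : cod ∘ unt = idm C0
}.

Definition is_reflexive_relation (C : category) (G : reflexive_graph C) : Prop :=
  jointly_monic (dom G) (cod G).

(* The square needed to form <1, e d> : C1 -> C2.                             *)
Lemma unitr_comm (C : category) (G : reflexive_graph C) :
  dom G ∘ idm (C1 G) = cod G ∘ (unt G ∘ dom G).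
Proof. by rewrite comp_assoc cod_unt comp_idl comp_idr. Qed.

(* The square needed to form <e c, 1> : C1 -> C2.                             *)
Lemma unitl_comm (C : category) (G : reflexive_graph C) :
  dom G ∘ (unt G ∘ cod G) = cod G ∘ idm (C1 G).
Proof. by rewrite comp_assoc dom_unt comp_idl comp_idr. Qed.

Record multiplicative_structure (C : category) (G : reflexive_graph C) :=
  MultiplicativeStructure {
  C2 : pullback (dom G) (cod G);
  mul : hom C2 (C1 G);
  mul_unitr : mul ∘ pb_pair C2 (idm (C1 G)) (unt G ∘ dom G) (unitr_comm G)
              = idm (C1 G);
  mul_unitl : mul ∘ pb_pair C2 (unt G ∘ cod G) (idm (C1 G)) (unitl_comm G)
              = idm (C1 G);
  dom_mul : dom G ∘ mul = dom G ∘ pb2 C2;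
  cod_mul : cod G ∘ mul = cod G ∘ pb1 C2
}.

Section Associativity.
Variables (C : category) (G : reflexive_graph C).
Variable M : multiplicative_structure G.

(* The object C1 x_C0 C1 x_C0 C1 of composable triples (x, y, z) is presented *)
(* as the pullback of pairs ((x, y), (y, z)).                                 *)
Definition composable_triples := pullback (pb2 (C2 M)) (pb1 (C2 M)).

Variable T : composable_triples.

Lemma one_mul_comm :
  dom G ∘ (pb1 (C2 M) ∘ pb1 T) = cod G ∘ (mul M ∘ pb2 T).
Proof.
rewrite !comp_assoc cod_mul (pb_comm (C2 M)) -!comp_assoc.
by rewrite (pb_comm T).
Qed.

Lemma mul_one_comm :
  dom G ∘ (mul M ∘ pb1 T) = cod G ∘ (pb2 (C2 M) ∘ pb2 T).
Proof.
rewrite !comp_assoc dom_mul -(pb_comm (C2 M)) -!comp_assoc.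
by rewrite (pb_comm T).
Qed.

Definition one_mul : hom T (C2 M) :=
  pb_pair (C2 M) (pb1 (C2 M) ∘ pb1 T) (mul M ∘ pb2 T) one_mul_comm.

Definition mul_one : hom T (C2 M) :=
  pb_pair (C2 M) (mul M ∘ pb1 T) (pb2 (C2 M) ∘ pb2 T) mul_one_comm.

End Associativity.

Record category_structure (C : category) (G : reflexive_graph C) :=
  CategoryStructure {
  cat_mul :> multiplicative_structure G;
  C3 : composable_triples cat_mul;
  mul_assoc : mul cat_mul ∘ one_mul C3 = mul cat_mul ∘ mul_one C3
}.

Lemma invr_comm (C : category) (G : reflexive_graph C)
    (t : hom (C1 G) (C1 G)) :
  cod G ∘ t = dom G -> dom G ∘ idm (C1 G) = cod G ∘ t.
Proof. by move=> ->; rewrite comp_idr. Qed.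

Lemma invl_comm (C : category) (G : reflexive_graph C)
    (t : hom (C1 G) (C1 G)) :
  dom G ∘ t = cod G -> dom G ∘ t = cod G ∘ idm (C1 G).
Proof. by move=> ->; rewrite comp_idr. Qed.

Record groupoid_structure (C : category) (G : reflexive_graph C) :=
  GroupoidStructure {
  grp_cat :> category_structure G;
  inv : hom (C1 G) (C1 G);
  cod_inv : cod G ∘ inv = dom G;
  dom_inv : dom G ∘ inv = cod G;
  mul_invr : mul grp_cat
             ∘ pb_pair (C2 grp_cat) (idm (C1 G)) inv (invr_comm cod_inv)
             = unt G ∘ cod G;
  mul_invl : mul grp_cat
             ∘ pb_pair (C2 grp_cat) inv (idm (C1 G)) (invl_comm dom_inv)
             = unt G ∘ dom G
}.

Definition is_transitive (C : category) (G : reflexive_graph C) : Prop :=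
  inhabited (multiplicative_structure G).

Definition is_preorder (C : category) (G : reflexive_graph C) : Prop :=
  is_reflexive_relation G /\ inhabited (category_structure G).

Definition is_equivalence_relation (C : category) (G : reflexive_graph C) :
    Prop :=
  is_reflexive_relation G /\ inhabited (groupoid_structure G).

Section Pregroupoids.
Variables (C : category) (D D0 D0' : C) (d : hom D D0) (c : hom D D0').

Section Triple.
Variables (Kd : pullback d d) (Kc : pullback c c).
Variable T : pullback (pb2 Kd) (pb1 Kc).
Variables (X : C) (x y z : hom X D) (dxy : d ∘ x = d ∘ y) (cyz : c ∘ y = c ∘ z).

Lemma triple_comm : pb2 Kd ∘ pb_pair Kd x y dxy = pb1 Kc ∘ pb_pair Kc y z cyz.
Proof. by rewrite pb2_pair pb1_pair. Qed.

Definition triple : hom X T :=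
  pb_pair T (pb_pair Kd x y dxy) (pb_pair Kc y z cyz) triple_comm.

End Triple.

Arguments triple {Kd Kc} T {X} x y z dxy cyz.

(* The equations are stated on generalised elements x, y, z : X -> D; in      *)
(* [pgd_xyy] and [pgd_xxy] one of the two side conditions is trivial.         *)
Record pregroupoid_structure := PregroupoidStructure {
  pgd_Kd : pullback d d;
  pgd_Kc : pullback c c;
  pgd_T : pullback (pb2 pgd_Kd) (pb1 pgd_Kc);
  pgd_p : hom pgd_T D;
  pgd_xyy : forall (X : C) (x y : hom X D) (dxy : d ∘ x = d ∘ y),
    pgd_p ∘ triple pgd_T x y y dxy erefl = x;
  pgd_xxy : forall (X : C) (x y : hom X D) (cxy : c ∘ x = c ∘ y),
    pgd_p ∘ triple pgd_T x x y erefl cxy = y;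
  pgd_dom : forall (X : C) (x y z : hom X D)
    (dxy : d ∘ x = d ∘ y) (cyz : c ∘ y = c ∘ z),
    d ∘ (pgd_p ∘ triple pgd_T x y z dxy cyz) = d ∘ z;
  pgd_cod : forall (X : C) (x y z : hom X D)
    (dxy : d ∘ x = d ∘ y) (cyz : c ∘ y = c ∘ z),
    c ∘ (pgd_p ∘ triple pgd_T x y z dxy cyz) = c ∘ x
}.

Definition is_difunctional : Prop := inhabited pregroupoid_structure.

End Pregroupoids.

Section SplitPullback.
Variables (C : category) (A B E : C).
Variables (f : hom A B) (r : hom B A) (g : hom E B) (s : hom B E).
Variables (fr : f ∘ r = idm B) (gs : g ∘ s = idm B) (P : pullback f g).

Lemma split_inl_comm : f ∘ idm A = g ∘ (s ∘ f).
Proof. by rewrite comp_assoc gs comp_idl comp_idr. Qed.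

Lemma split_inr_comm : f ∘ (r ∘ g) = g ∘ idm E.
Proof. by rewrite comp_assoc fr comp_idl comp_idr. Qed.

(* e1 = <1, s f> and e2 = <r g, 1>.                                           *)
Definition split_inl : hom A P := pb_pair P (idm A) (s ∘ f) split_inl_comm.
Definition split_inr : hom E P := pb_pair P (r ∘ g) (idm E) split_inr_comm.

End SplitPullback.

Arguments split_inl {C A B E f g s} gs P.
Arguments split_inr {C A B E f r g} fr P.

(* Main.v *)
(* Generalised elements reduce everything to first-order statements about
   spans: since the legs of a relation are jointly monic, a structure map exists
   as soon as a map with the prescribed composites with the legs does, and the
   remaining equations hold automatically.
   For (iii') => (iv'), attach to a relation (d, c) on D the reflexive relation
   a ~ b on D meaning "(d a, c b) belongs to D"; it is represented by the object
   of triples (a, w, b) with d a = d w and c w = c b.  If d x = d y and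
   c y = c z, then z ~ y (witness z) and y ~ x (witness x), so transitivity
   yields the required w with d w = d z and c w = c x.  Conversely (v') supplies
   such a w for every relation; on a reflexive relation, the triple (g, 1, f)
   gives the composite of g and f, and (1, f, 1) gives the inverse of f. *)

Require Import Defs.
From mathcomp Require Import all_boot.
Local Open Scope category_scope.

Section Relations.
Set Implicit Arguments.
Unset Strict Implicit.

Variable CC : category.

(** Free of any choice of pullbacks, and without the identities for [p(x, y, y)] and [p(x, x, y)]:
    on a relation the two leg equations determine [w] and force them. *)
Definition difunctional_on_elements (D D0 D0' : CC)
    (d : hom D D0) (c : hom D D0') : Prop :=
  forall (X : CC) (x y z : hom X D), d ∘ x = d ∘ y -> c ∘ y = c ∘ z ->
  exists w : hom X D, d ∘ w = d ∘ z /\ c ∘ w = c ∘ x.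

Section Triples.
Variables (D D0 D0' : CC) (d : hom D D0) (c : hom D D0').
Variables (Kd : pullback d d) (Kc : pullback c c).

(** Both projections are split by the diagonals of the kernel pairs. *)
Lemma exists_triples :
  has_split_pullbacks CC -> inhabited (pullback (pb2 Kd) (pb1 Kc)).
Proof.
apply.
- by exists (pb_pair Kd (idm D) (idm D) erefl); rewrite pb2_pair.
- by exists (pb_pair Kc (idm D) (idm D) erefl); rewrite pb1_pair.
Qed.

Variable T : pullback (pb2 Kd) (pb1 Kc).

Lemma dom_fst_snd_triples : d ∘ (pb1 Kd ∘ pb1 T) = d ∘ (pb2 Kd ∘ pb1 T).
Proof. by rewrite !comp_assoc (pb_comm Kd). Qed.

Lemma cod_snd_thd_triples : c ∘ (pb2 Kd ∘ pb1 T) = c ∘ (pb2 Kc ∘ pb2 T).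
Proof. by rewrite (pb_comm T) !comp_assoc (pb_comm Kc). Qed.

Section Projections.
Variables (X : CC) (x y z : hom X D).
Variables (dxy : d ∘ x = d ∘ y) (cyz : c ∘ y = c ∘ z).

Lemma fst_triple : pb1 Kd ∘ pb1 T ∘ triple T dxy cyz = x.
Proof. by rewrite -comp_assoc !pb1_pair. Qed.

Lemma snd_triple : pb2 Kd ∘ pb1 T ∘ triple T dxy cyz = y.
Proof. by rewrite -comp_assoc pb1_pair pb2_pair. Qed.

Lemma thd_triple : pb2 Kc ∘ pb2 T ∘ triple T dxy cyz = z.
Proof. by rewrite -comp_assoc !pb2_pair. Qed.

End Projections.

(* The middle component is determined by the outer ones because (d, c) is
   jointly monic; hence triples form a relation between the outer ones. *)
Lemma jointly_monic_triples : jointly_monic d c ->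
  jointly_monic (pb2 Kc ∘ pb2 T) (pb1 Kd ∘ pb1 T).
Proof.
move=> dc X u v; rewrite -!comp_assoc => u3 u1.
have u2 : pb2 Kd ∘ (pb1 T ∘ u) = pb2 Kd ∘ (pb1 T ∘ v).
  apply: dc.
  - by rewrite comp_assoc -(pb_comm Kd) -comp_assoc u1 comp_assoc (pb_comm Kd)
               -comp_assoc.
  - rewrite !(comp_assoc (pb2 Kd)) (pb_comm T) !comp_assoc (pb_comm Kc).
    by rewrite -!(comp_assoc (c ∘ _)) -!(comp_assoc c) u3.
apply: pb_uniq; apply: pb_uniq => //.
by rewrite !comp_assoc -(pb_comm T) -!comp_assoc.
Qed.

End Triples.

(** The structure map [p] is the [w] of the generic triple, formed by the three projections of
    [T]. *)
Lemma difunctionalP (D D0 D0' : CC) (d : hom D D0) (c : hom D D0') :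
  has_kernel_pairs CC -> has_split_pullbacks CC -> is_relation d c ->
  is_difunctional d c <-> difunctional_on_elements d c.
Proof.
move=> hK hS dc; split=> [[p] X x y z dxy cyz | difun].
  by exists (pgd_p p ∘ triple (pgd_T p) dxy cyz); rewrite pgd_dom pgd_cod.
have [Kd] := hK _ _ d; have [Kc] := hK _ _ c.
have [T] := exists_triples Kd Kc hS.
have [p [dp cp]] :=
  difun _ _ _ _ (dom_fst_snd_triples T) (cod_snd_thd_triples T).
have dpt X x y z dxy cyz : d ∘ (p ∘ @triple _ _ _ _ _ _ _ _ T X x y z dxy cyz)
    = d ∘ z.
  by rewrite comp_assoc dp -comp_assoc thd_triple.
have cpt X x y z dxy cyz : c ∘ (p ∘ @triple _ _ _ _ _ _ _ _ T X x y z dxy cyz)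
    = c ∘ x.
  by rewrite comp_assoc cp -comp_assoc fst_triple.
constructor; apply: (@PregroupoidStructure _ _ _ _ _ _ Kd Kc T p) => //.
- by move=> X x y dxy; apply: dc; rewrite ?dpt ?cpt.
- by move=> X x y cxy; apply: dc; rewrite ?dpt ?cpt.
Qed.

Lemma difunctional_of_transitive :
    has_kernel_pairs CC -> has_split_pullbacks CC ->
    (forall G : reflexive_graph CC, is_reflexive_relation G -> is_transitive G) ->
  forall (D D0 D0' : CC) (d : hom D D0) (c : hom D D0'),
  is_relation d c -> difunctional_on_elements d c.
Proof.
move=> hK hS htrans D D0 D0' d c dc X x y z dxy cyz.
have [Kd] := hK _ _ d; have [Kc] := hK _ _ c.
have [T] := exists_triples Kd Kc hS.
pose diag := triple T (erefl (d ∘ idm D)) (erefl (c ∘ idm D)).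
pose G := ReflexiveGraph (thd_triple T erefl erefl : _ ∘ diag = _)
                         (fst_triple T erefl erefl).
have [M] := htrans G (jointly_monic_triples dc).
(* The triples [(z, z, y)] and [(y, x, x)], composable at [y]; the middle component of their
   composite is the required [w]. *)
pose zy := triple T (erefl (d ∘ z)) (esym cyz).
pose yx := triple T (esym dxy) (erefl (c ∘ x)).
have zyx : dom G ∘ zy = cod G ∘ yx by rewrite thd_triple fst_triple.
pose zx := Defs.mul M ∘ pb_pair (C2 M) zy yx zyx.
have zx1 : pb1 Kd ∘ pb1 T ∘ zx = z.
  by rewrite comp_assoc (cod_mul M) -comp_assoc pb1_pair fst_triple.
have zx3 : pb2 Kc ∘ pb2 T ∘ zx = x.
  by rewrite comp_assoc (dom_mul M) -comp_assoc pb2_pair thd_triple.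
exists (pb2 Kd ∘ pb1 T ∘ zx); split.
- by rewrite comp_assoc -dom_fst_snd_triples -comp_assoc zx1.
- by rewrite comp_assoc cod_snd_thd_triples -comp_assoc zx3.
Qed.

Lemma equivalence_of_difunctional (G : reflexive_graph CC) :
  has_split_pullbacks CC -> is_reflexive_relation G ->
  difunctional_on_elements (dom G) (cod G) -> is_equivalence_relation G.
Proof.
move=> hS dc difun; split=> //.
have [||P] := hS _ _ _ (dom G) (cod G).
- by exists (unt G); rewrite dom_unt.
- by exists (unt G); rewrite cod_unt.
(* The middle entry is the identity at the object where the two arrows meet. *)
have [||m [dm cm]] := difun P (pb1 P) (unt G ∘ dom G ∘ pb1 P) (pb2 P).
- by rewrite !comp_assoc dom_unt comp_idl.
- by rewrite !comp_assoc cod_unt comp_idl (pb_comm P).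
have dmp X a b H : dom G ∘ (m ∘ @pb_pair _ _ _ _ _ _ P X a b H) = dom G ∘ b.
  by rewrite comp_assoc dm -comp_assoc pb2_pair.
have cmp X a b H : cod G ∘ (m ∘ @pb_pair _ _ _ _ _ _ P X a b H) = cod G ∘ a.
  by rewrite comp_assoc cm -comp_assoc pb1_pair.
have mr : m ∘ pb_pair P (idm _) (unt G ∘ dom G) (unitr_comm G) = idm _.
  by apply: dc; rewrite ?dmp ?cmp // comp_assoc dom_unt comp_idl comp_idr.
have ml : m ∘ pb_pair P (unt G ∘ cod G) (idm _) (unitl_comm G) = idm _.
  by apply: dc; rewrite ?dmp ?cmp // comp_assoc cod_unt comp_idl comp_idr.
pose M := MultiplicativeStructure mr ml dm cm.
(* These projections are split by [<e c, 1>] and [<1, e d>] respectively. *)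
have [||T] := hS _ _ _ (pb2 P) (pb1 P).
- by eexists; apply: pb2_pair (unitl_comm G).
- by eexists; apply: pb1_pair (unitr_comm G).
have mA : Defs.mul M ∘ @one_mul _ _ M T = Defs.mul M ∘ @mul_one _ _ M T.
  by apply: dc; rewrite ?dmp ?cmp !comp_assoc ?dm ?cm.
pose S := CategoryStructure mA.
have [||t [dt ct]] := difun _ (unt G ∘ dom G) (idm _) (unt G ∘ cod G).
- by rewrite comp_assoc dom_unt comp_idl comp_idr.
- by rewrite comp_assoc cod_unt comp_idl comp_idr.
move: dt ct; rewrite !comp_assoc dom_unt cod_unt !comp_idl => dt ct.
constructor; apply: (@GroupoidStructure _ _ S t ct dt).
all: apply: dc; rewrite ?dmp ?cmp !comp_assoc ?dom_unt ?cod_unt.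
all: by rewrite ?comp_idl ?comp_idr.
Qed.

End Relations.

Theorem theorem2p5 (CC : category)
    (hK : has_kernel_pairs CC) (hS : has_split_pullbacks CC) :
  [<-> (* (i') *)
       forall G : reflexive_graph CC,
         is_reflexive_relation G -> is_equivalence_relation G;
       (* (ii') *)
       forall G : reflexive_graph CC,
         is_reflexive_relation G -> is_preorder G;
       (* (iii') *)
       forall G : reflexive_graph CC,
         is_reflexive_relation G -> is_transitive G;
       (* (iv') *)
       forall (D D0 D0' : CC) (d : hom D D0) (c : hom D D0'),
         is_relation d c -> is_difunctional d c;
       (* (v') *)
       forall (A B C D : CC)
         (f : hom A B) (r : hom B A) (g : hom C B) (s : hom B C)
         (alpha : hom A D) (beta : hom B D) (gamma : hom C D)
         (fr : f ∘ r = idm B) (gs : g ∘ s = idm B),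
         alpha ∘ r = beta -> gamma ∘ s = beta ->
         forall (D0 D0' : CC) (d : hom D D0) (c : hom D D0'),
         is_relation d c ->
         d ∘ alpha = d ∘ beta ∘ f -> c ∘ gamma = c ∘ beta ∘ g ->
         forall P : pullback f g,
         exists! phi : hom P D,
           phi ∘ split_inl gs P = alpha /\
           phi ∘ split_inr fr P = gamma /\
           d ∘ phi = d ∘ gamma ∘ pb2 P /\
           c ∘ phi = c ∘ alpha ∘ pb1 P].
Proof.
tfae.
- by move=> h G /h [G_rel [S]]; split=> //; constructor; apply: grp_cat S.
- by move=> h G /h [_ [S]]; constructor; apply: cat_mul S.
- move=> h D D0 D0' d c dc; apply/(difunctionalP hK hS dc).
  exact: difunctional_of_transitive dc.
- move=> h A B C D f r g s alpha beta gamma fr gs ar gs' D0 D0' d c dc da cg P.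
  have difun := proj1 (difunctionalP hK hS dc) (h _ _ _ _ _ dc).
  (* The middle entry is [beta] at the common image in [B]; the hypotheses on [d ∘ alpha] and
     [c ∘ gamma] make this a triple. *)
  have [||phi [dphi cphi]] :=
    difun P (alpha ∘ pb1 P) (beta ∘ f ∘ pb1 P) (gamma ∘ pb2 P).
  + by rewrite !comp_assoc da.
  + by rewrite -(comp_assoc beta) (pb_comm P) !comp_assoc cg.
  exists phi; split; last first.
    move=> psi [_ [_ [dpsi cpsi]]].
    by apply: dc; rewrite ?dpsi ?cpsi ?dphi ?cphi comp_assoc.
  rewrite !comp_assoc in dphi cphi; split; last split=> //; apply: dc.
  + by rewrite comp_assoc dphi -comp_assoc pb2_pair da -gs' !comp_assoc.
  + by rewrite comp_assoc cphi -comp_assoc pb1_pair comp_idr.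
  + by rewrite comp_assoc dphi -comp_assoc pb2_pair comp_idr.
  + by rewrite comp_assoc cphi -comp_assoc pb1_pair cg -ar !comp_assoc.
- move=> h G G_rel; apply: equivalence_of_difunctional => // X x y z dxy cyz.
  have [Kd] := hK _ _ (dom G); have [Kc] := hK _ _ (cod G).
  have [T] := exists_triples Kd Kc hS.
  (* With [f], [g] the kernel pair projections split by the diagonals and [beta] the identity, the
     pullback in (v') is the object of triples, so [phi] is the generic [w]. *)
  pose dd := pb_pair Kd (idm _) (idm _) erefl.
  pose dc := pb_pair Kc (idm _) (idm _) erefl.
  have [||||phi [[_ [_ [dphi cphi]]] _]] :=
    h _ _ _ _ (pb2 Kd) dd (pb1 Kc) dc (pb1 Kd) (idm _) (pb2 Kc)
      (pb2_pair _ _) (pb1_pair _ _) _ _ _ _ (dom G) (cod G) G_rel _ _ T.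
  + exact: pb1_pair.
  + exact: pb2_pair.
  + by rewrite comp_idr (pb_comm Kd).
  + by rewrite comp_idr (pb_comm Kc).
  exists (phi ∘ triple T dxy cyz); rewrite !comp_assoc dphi cphi.
  by rewrite -!(comp_assoc (_ G)) thd_triple fst_triple.
Qed.
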